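(* Let $S$ be an $n$-dimensional statistical manifold, let $\alpha\in\mathbb{R}$, and let $\nabla^{(\alpha)}$ be the $\alpha$-connection on $S$, with torsion tensor $T^{(\alpha)}$ and curvature tensor $R^{(\alpha)}$. Let $\pi:F(S)\to S$ be the frame bundle of $S$ with canonical 1-form $\theta$, equipped with the connection $H^{(\alpha)}$, $\alpha$-torsion form $\Theta^{(\alpha)}$ and $\alpha$-curvature form $\Omega^{(\alpha)}$. Then: (i) for a smooth curve $\gamma:(-\epsilon,\epsilon)\to S$ with horizontal lift $\widetilde\gamma$ to $F(S)$ with respect to $H^{(\alpha)}$, $$\gamma\text{ is an }\alpha\text{-geodesic}\iff\nabla^{(\alpha)}_{\gamma'}\gamma'=0\iff\widetilde\gamma'(\theta(\widetilde\gamma'))=0,$$ where $\widetilde\gamma'(\theta(\widetilde\gamma'))$ denotes $\frac{d}{dt}\,\theta(\widetilde\gamma'(t))$; (ii) $(S,\nabla^{(\alpha)})$ is torsion free $\iff T^{(\alpha)}=0\iff\Theta^{(\alpha)}=0$; (iii) $(S,\nabla^{(\alpha)})$ is flat $\iff R^{(\alpha)}=0\iff\Omega^{(\alpha)}=0$.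
   Context: **Statistical manifold and $\alpha$-connection.** A statistical manifold is a family $S=\{p(x;\vartheta):\vartheta\in\Theta_0\}$ of probability density functions on a sample space, parametrized by an open set $\Theta_0\subset\mathbb{R}^n$, where $\vartheta$ serves as coordinates on $S$. The family satisfies the usual regularity conditions: $p>0$, smooth dependence on $\vartheta$, $\vartheta\mapsto p(\cdot;\vartheta)$ injective, all expectations below exist and are smooth in $\vartheta$, and the Fisher matrix is positive definite. Put $l=\log p(x;\vartheta)$, and let $E$ be the expectation with respect to $p(x;\vartheta)$. The Riemannian (Fisher) metric is $g_{ij}=E[(\partial_il)(\partial_jl)]$, also written $\langle\cdot,\cdot\rangle$. For $\alpha\in\mathbb{R}$, the $\alpha$-connection $\nabla^{(\alpha)}$ is the affine connection on $S$ given by $$\langle\nabla^{(\alpha)}_AB,C\rangle=E[(A(Bl))(Cl)]+\tfrac{1-\alpha}{2}E[(Al)(Bl)(Cl)],\qquad A,B,C\in\mathfrak{X}(S).$$ In a chart $(U_\beta,x_\beta^i)$ of $S$ its coefficients $(\Gamma_\beta^{(\alpha)})^k_{ij}$ are defined by $\nabla^{(\alpha)}_{\partial_i}\partial_j=(\Gamma_\beta^{(\alpha)})^k_{ij}\partial_k$ with $\partial_i=\partial/\partial x^i_\beta$ (summation convention). A smooth curve $\gamma$ is an $\alpha$-geodesic if $\nabla^{(\alpha)}_{\gamma'(t)}\gamma'(t)=0$ for all $t$. $(S,\nabla^{(\alpha)})$ is torsion free if $\nabla^{(\alpha)}_XY-\nabla^{(\alpha)}_YX-[X,Y]=0$ for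 all $X,Y\in\mathfrak{X}(S)$, and flat if $\nabla^{(\alpha)}_X\nabla^{(\alpha)}_YZ-\nabla^{(\alpha)}_Y\nabla^{(\alpha)}_XZ-\nabla^{(\alpha)}_{[X,Y]}Z=0$ for all $X,Y,Z\in\mathfrak{X}(S)$. **Frame bundle.** $F(S)$ is the frame bundle of $TS$, a principal $GL(n;\mathbb{R})$-bundle with projection $\pi$ and right action $R_g(u)=ug$. A point $u\in F(S)$ is identified with the linear isomorphism $u:\mathbb{R}^n\to T_{\pi(u)}S$, $\xi\mapsto u\xi$. Over $U_\beta$, the local trivialization $\phi_\beta:\pi^{-1}(U_\beta)\to GL(n;\mathbb{R})$ is given by $u\xi=(\phi_\beta(u))^i_j\xi^j\partial_i$. The canonical 1-form $\theta$ on $F(S)$ is the $\mathbb{R}^n$-valued 1-form $\theta(Y_u)=u^{-1}(\pi_*Y_u)$, $Y_u\in T_uF(S)$. **The connection $H^{(\alpha)}$.** On $U_\beta$ define the $gl(n;\mathbb{R})$-valued 1-form $\omega^{(\alpha)}_\beta$ with entries $(\omega^{(\alpha)}_\beta)^k_j=(\Gamma^{(\alpha)}_\beta)^k_{ji}\,dx^i_\beta$. On $\pi^{-1}(U_\beta)$ define $$\widetilde\omega^{(\alpha)}_\beta(u)=Ad(\phi_\beta(u)^{-1})\circ\pi^*\omega^{(\alpha)}_\beta(u)+(\phi_\beta^*\theta_{G})(u),$$ where $\theta_G(X_g)=(L_g)_*^{-1}X_g$ is the left-invariant Maurer–Cartan form of $G=GL(n;\mathbb{R})$. These local forms agree on overlaps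 and define a global $gl(n;\mathbb{R})$-valued 1-form $\widetilde\omega^{(\alpha)}$ on $F(S)$, which is the connection form of a unique principal connection $H^{(\alpha)}=\ker\widetilde\omega^{(\alpha)}$. Let $h^{(\alpha)}$ be the projection of $TF(S)$ onto $H^{(\alpha)}$ along the vertical bundle $\ker\pi_*$. The horizontal lift $\widetilde X^{(\alpha)}$ of $X\in\mathfrak{X}(S)$ (or of a tangent vector) is the unique one with values in $H^{(\alpha)}$ and $\pi_*\widetilde X^{(\alpha)}=X$. A horizontal lift of a curve $\gamma$ is a curve $\widetilde\gamma$ in $F(S)$ with $\pi(\widetilde\gamma(t))=\gamma(t)$ and $\widetilde\gamma'(t)\in H^{(\alpha)}_{\widetilde\gamma(t)}$ for all $t$; it is unique once its initial point is fixed, and different lifts differ by a constant right translation. **Torsion and curvature.** $\Theta^{(\alpha)}=d\theta\circ h^{(\alpha)}$ and $\Omega^{(\alpha)}=d\widetilde\omega^{(\alpha)}\circ h^{(\alpha)}$, where $(d\eta\circ h)(X,Y)=d\eta(hX,hY)$ and $d\eta(X,Y)=X(\eta(Y))-Y(\eta(X))-\eta([X,Y])$. For $X,Y,Z\in T_pS$ and $u\in\pi^{-1}(p)$, $T^{(\alpha)}(X,Y):=u(\Theta^{(\alpha)}(\widetilde X^{(\alpha)},\widetilde Y^{(\alpha)}))$ and $R^{(\alpha)}(X,Y)Z:=u(\Omega^{(\alpha)}(\widetilde X^{(\alpha)},\widetilde Y^{(\alpha)})u^{-1}(Z))$, with the lifts taken at $u$; these do not depend on the choice of $u$. *)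

(* Defs.v *)
From HB Require Import structures.
From mathcomp Require Import all_boot all_order all_algebra.
From mathcomp Require Import all_classical all_reals all_analysis.
Set Implicit Arguments.
Unset Strict Implicit.
Unset Printing Implicit Defensive.
Import Order.TTheory GRing.Theory Num.Theory.
Import numFieldNormedType.Exports.
Local Open Scope classical_set_scope.
Local Open Scope ring_scope.

(* Calculus on an open subset U of a finite-dimensional space V. A tangent
   vector is an element of V, a vector field is a map V -> V and a W-valued
   1-form is a map V -> V -> W (base point first); only their values at points
   of U matter. *)
Section Calculus.
Context {R : realType} {V W : normedModType R}.

Fixpoint Ck_on (k : nat) (U : set V) (f : V -> W) : Prop :=
  match k with
  | 0 => forall x, U x -> {for x, continuous f}
  | k'.+1 => (forall x, U x -> differentiable f x) /\
             (forall v : V, Ck_on k' U ('D_v f))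
  end.

Definition smooth_on (U : set V) (f : V -> W) : Prop :=
  forall k, Ck_on k U f.

(* The function X f, for X a vector field. *)
Definition vf_act (X : V -> V) (f : V -> W) : V -> W :=
  fun q => 'D_(X q) f q.

End Calculus.

(* [X, Y]^k = X^i d_i Y^k - Y^i d_i X^k *)
Definition lie_bracket {R : realType} {V : normedModType R} (X Y : V -> V)
    : V -> V :=
  fun q => vf_act X Y q - vf_act Y X q.

Definition ext_d {R : realType} {V W : normedModType R} (eta : V -> V -> W)
    (X Y : V -> V) : V -> W :=
  fun q => vf_act X (fun r => eta r (Y r)) q
           - vf_act Y (fun r => eta r (X r)) q
           - eta q (lie_bracket X Y q).

Section Likelihood.
Context {R : realType} {d : measure_display} {T : measurableType d}.
Variables (mu : {measure set T -> \bar R}) (n : nat).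
Variable p : 'cV[R]_n -> T -> R.

Definition basis_vec (i : 'I_n) : 'cV[R]_n := delta_mx i 0.

Definition loglik (x : T) : 'cV[R]_n -> R := fun v => ln (p v x).

Definition dloglik (i : 'I_n) (v : 'cV[R]_n) (x : T) : R :=
  'D_(basis_vec i) (loglik x) v.

Definition d2loglik (i j : 'I_n) (v : 'cV[R]_n) (x : T) : R :=
  'D_(basis_vec i) (fun w => dloglik j w x) v.

Definition expect (v : 'cV[R]_n) (f : T -> R) : R :=
  \int[mu]_x (f x * p v x).

Definition expect_exists_smooth (Theta : set 'cV[R]_n)
    (f : 'cV[R]_n -> T -> R) : Prop :=
  (forall v, Theta v -> mu.-integrable setT (fun x => (f v x * p v x)%:E)) /\
  smooth_on Theta (fun v => expect v (f v)).

Definition fisher_mx (v : 'cV[R]_n) : 'M[R]_n :=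
  \matrix_(i, j) expect v (fun x => dloglik i v x * dloglik j v x).

Definition fisher_dot (v a b : 'cV[R]_n) : R :=
  \sum_i \sum_j fisher_mx v i j * a i 0 * b j 0.

End Likelihood.

(* A statistical manifold is represented in its global coordinates: the point
   p(. ; v) of S is identified with v in [params], and T S with
   [params] * 'cV_n. Densities are taken with respect to mu. The expectations
   E[(A (B l)) (C l)] and E[(A l) (B l) (C l)] for general vector fields are
   linear combinations, with coefficients depending on the base point only, of
   the coordinate ones required below. *)
Record stat_manifold (R : realType) (d : measure_display)
    (T : measurableType d) (mu : {measure set T -> \bar R}) (n : nat) :=
  StatManifold {
  params : set 'cV[R]_n;
  dens : 'cV[R]_n -> T -> R;
  params_open : open params;
  dens_gt0 : forall v x, params v -> 0 < dens v x;
  dens_measurable : forall v, params v -> measurable_fun setT (dens v);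
  dens_prob : forall v, params v -> (\int[mu]_x (dens v x)%:E = 1)%E;
  dens_smooth : forall x, smooth_on params (fun v => dens v x);
  dens_inj : forall v w, params v -> params w -> dens v = dens w -> v = w;
  expect_dd : forall i j, expect_exists_smooth mu dens params
    (fun v x => dloglik dens i v x * dloglik dens j v x);
  expect_d2d : forall i j k, expect_exists_smooth mu dens params
    (fun v x => d2loglik dens i j v x * dloglik dens k v x);
  expect_ddd : forall i j k, expect_exists_smooth mu dens params
    (fun v x => dloglik dens i v x * dloglik dens j v x * dloglik dens k v x);
  fisher_posdef : forall v a, params v -> a != 0 ->
    0 < fisher_dot mu dens v a a }.

Section AlphaConnection.
Context {R : realType} {d : measure_display} {T : measurableType d}.
Context {mu : {measure set T -> \bar R}} {n : nat}.
Variables (S : stat_manifold mu n) (alpha : R).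

Definition vector_field (X : 'cV[R]_n -> 'cV[R]_n) : Prop :=
  smooth_on (params S) X.

(* The right-hand side of the formula defining <nabla_A B, C> at v. *)
Definition alpha_rhs (A B C : 'cV[R]_n -> 'cV[R]_n) (v : 'cV[R]_n) : R :=
  let l := loglik (dens S) in
  expect mu (dens S) v
    (fun x => vf_act A (vf_act B (l x)) v * vf_act C (l x) v)
  + (1 - alpha) / 2 * expect mu (dens S) v
    (fun x => vf_act A (l x) v * vf_act B (l x) v * vf_act C (l x) v).

(* [get] picks the vector characterized by the condition. For v in [params] it
   exists and is unique: [alpha_rhs] depends linearly on C v, and the Fisher
   metric is positive definite. *)
Definition alpha_nabla (A B : 'cV[R]_n -> 'cV[R]_n) : 'cV[R]_n -> 'cV[R]_n :=
  fun v => get [set w : 'cV[R]_n | forall C, vector_field C ->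
                  fisher_dot mu (dens S) v w (C v) = alpha_rhs A B C v].

(* nabla_{d_i} d_j = Gamma^k_ij d_k *)
Definition Gamma (k i j : 'I_n) (v : 'cV[R]_n) : R :=
  alpha_nabla (cst (basis_vec i)) (cst (basis_vec j)) v k 0.

(* The covariant derivative nabla_{gamma'} W of a vector field W along gamma:
   (W^k)' + Gamma^k_ij gamma'^i W^j. *)
Definition alpha_nabla_along (gamma W : R -> 'cV[R]_n) (t : R) : 'cV[R]_n :=
  let gamma' : 'cV[R]_n := derive1 gamma t in
  let W' : 'cV[R]_n := derive1 W t in
  \col_k (W' k 0 +
    \sum_i \sum_j Gamma k i j (gamma t) * gamma' i 0 * W t j 0).

Definition curve_dom (eps : R) : set R := [set t | - eps < t < eps].

Definition smooth_curve (eps : R) (gamma : R -> 'cV[R]_n) : Prop :=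
  smooth_on (curve_dom eps) gamma /\
  (forall t, curve_dom eps t -> params S (gamma t)).

Definition alpha_geodesic (eps : R) (gamma : R -> 'cV[R]_n) : Prop :=
  forall t, curve_dom eps t -> alpha_nabla_along gamma (derive1 gamma) t = 0.

Definition alpha_torsion_free : Prop :=
  forall X Y, vector_field X -> vector_field Y ->
  forall v, params S v ->
    alpha_nabla X Y v - alpha_nabla Y X v - lie_bracket X Y v = 0.

Definition alpha_flat : Prop :=
  forall X Y Z, vector_field X -> vector_field Y -> vector_field Z ->
  forall v, params S v ->
    alpha_nabla X (alpha_nabla Y Z) v - alpha_nabla Y (alpha_nabla X Z) v
    - alpha_nabla (lie_bracket X Y) Z v = 0.

End AlphaConnection.

(* Through u |-> (pi u, phi u), F(S) is the open subset params * GL(n) of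
   'cV_n * 'M_n; its tangent space at every point is 'cV_n * 'M_n, on which
   pi_* and phi_* are again the two projections. *)
Section FrameBundle.
Context {R : realType} {n : nat}.
Local Notation FT := ('cV[R]_n * 'M[R]_n)%type.

Definition frame_pi (u : FT) : 'cV[R]_n := u.1.
Definition frame_phi (u : FT) : 'M[R]_n := u.2.
Definition pi_push (Y : FT) : 'cV[R]_n := Y.1.
Definition phi_push (Y : FT) : 'M[R]_n := Y.2.

(* xi |-> u xi, with u xi = phi(u)^i_j xi^j d_i, and its inverse. *)
Definition frame_map (u : FT) (xi : 'cV[R]_n) : 'cV[R]_n := frame_phi u *m xi.
Definition frame_inv (u : FT) (X : 'cV[R]_n) : 'cV[R]_n :=
  invmx (frame_phi u) *m X.

Definition canonical_form (u Y : FT) : 'cV[R]_n := frame_inv u (pi_push Y).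

Definition vertical (Y : FT) : Prop := pi_push Y = 0.

Definition Ad (g X : 'M[R]_n) : 'M[R]_n := g *m X *m invmx g.
Definition maurer_cartan (g X : 'M[R]_n) : 'M[R]_n := invmx g *m X.

End FrameBundle.

Section PrincipalConnection.
Context {R : realType} {d : measure_display} {T : measurableType d}.
Context {mu : {measure set T -> \bar R}} {n : nat}.
Variables (S : stat_manifold mu n) (alpha : R).
Local Notation FT := ('cV[R]_n * 'M[R]_n)%type.

Definition frame_bundle : set FT :=
  [set u | params S (frame_pi u) /\ frame_phi u \in unitmx].

Definition frame_vector_field (X : FT -> FT) : Prop :=
  smooth_on frame_bundle X.

(* omega^k_j = Gamma^k_ji dx^i *)
Definition conn_local (v a : 'cV[R]_n) : 'M[R]_n :=
  \matrix_(k, j) \sum_i Gamma S alpha k j i v * a i 0.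

Definition conn_form (u Y : FT) : 'M[R]_n :=
  Ad (invmx (frame_phi u)) (conn_local (frame_pi u) (pi_push Y))
  + maurer_cartan (frame_phi u) (phi_push Y).

Definition horizontal (u Y : FT) : Prop := conn_form u Y = 0.

(* In the next two definitions [get] picks the unique element satisfying the
   condition, see [hor_projE] and [hor_liftE]. *)
Definition hor_proj (u Y : FT) : FT :=
  get [set Z : FT | horizontal u Z /\ vertical (Y - Z)].

Definition hor_lift (u : FT) (X : 'cV[R]_n) : FT :=
  get [set Z : FT | horizontal u Z /\ pi_push Z = X].

Lemma horizontalE (u Z : FT) : frame_bundle u ->
  horizontal u Z <->
  phi_push Z = - (conn_local (frame_pi u) (pi_push Z) *m frame_phi u).
Proof.
move=> Fu; have uu := Fu.2; rewrite /horizontal /conn_form /Ad /maurer_cartan invmxK.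
rewrite -mulmxA -mulmxDr; split=> [h|->]; last by rewrite subrr mulmx0.
apply/eqP; rewrite -subr_eq0 opprK addrC; apply/eqP.
by rewrite -[LHS](mulKVmx uu) h mulmx0.
Qed.

Lemma hor_liftE (u : FT) (X : 'cV[R]_n) : frame_bundle u ->
  [set Z : FT | horizontal u Z /\ pi_push Z = X] = [set hor_lift u X].
Proof.
move=> Fu; set P := [set Z : FT | _].
have P1 Z : P Z -> Z = (X, - (conn_local (frame_pi u) X *m frame_phi u)).
  by case: Z => a B [/(horizontalE _ Fu)]; rewrite /phi_push /pi_push /= => -> ->.
have Pw : P (X, - (conn_local (frame_pi u) X *m frame_phi u)).
  by split=> //; apply/(horizontalE _ Fu).
have Pg : P (hor_lift u X) by exact: (@xgetPex _ point P (ex_intro _ _ Pw)).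
apply/seteqP; split=> [Z PZ|Z ->] //.
by rewrite /= (P1 _ PZ) (P1 _ Pg).
Qed.

Lemma hor_projE (u Y : FT) : frame_bundle u ->
  [set Z : FT | horizontal u Z /\ vertical (Y - Z)] = [set hor_proj u Y].
Proof.
move=> Fu.
have E : [set Z : FT | horizontal u Z /\ vertical (Y - Z)] =
         [set Z : FT | horizontal u Z /\ pi_push Z = pi_push Y].
  apply/seteqP; split=> Z [hZ]; rewrite /vertical /pi_push /= => e; split=> //.
    by apply/eqP; rewrite eq_sym -subr_eq0; apply/eqP.
  by rewrite e subrr.
by rewrite /hor_proj E; exact: hor_liftE.
Qed.

Definition smooth_frame_curve (eps : R) (c : R -> FT) : Prop :=
  smooth_on (curve_dom eps) c /\
  (forall t, curve_dom eps t -> frame_bundle (c t)).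

Definition horizontal_lift_curve (eps : R) (gamma : R -> 'cV[R]_n)
    (c : R -> FT) : Prop :=
  smooth_frame_curve eps c /\
  (forall t, curve_dom eps t ->
     frame_pi (c t) = gamma t /\ horizontal (c t) (derive1 c t)).

Definition torsion_form (X Y : FT -> FT) : FT -> 'cV[R]_n :=
  ext_d canonical_form (fun u => hor_proj u (X u)) (fun u => hor_proj u (Y u)).

Definition curvature_form (X Y : FT -> FT) : FT -> 'M[R]_n :=
  ext_d conn_form (fun u => hor_proj u (X u)) (fun u => hor_proj u (Y u)).

(* The value of a 2-form at u on two tangent vectors: extend them to vector
   fields on F(S), here the constant ones. By tensoriality the extension does
   not matter. *)
Definition form2_at {W : Type} (Om : (FT -> FT) -> (FT -> FT) -> FT -> W)
    (u a b : FT) : W :=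
  Om (cst a) (cst b) u.

(* T(X, Y) and R(X, Y) Z at the point pi u, computed with the frame u. *)
Definition torsion_tensor (u : FT) (X Y : 'cV[R]_n) : 'cV[R]_n :=
  frame_map u (form2_at torsion_form u (hor_lift u X) (hor_lift u Y)).

Definition curvature_tensor (u : FT) (X Y Z : 'cV[R]_n) : 'cV[R]_n :=
  frame_map u (form2_at curvature_form u (hor_lift u X) (hor_lift u Y)
               *m frame_inv u Z).

Definition torsion_tensor_eq0 : Prop :=
  forall u, frame_bundle u -> forall X Y, torsion_tensor u X Y = 0.

Definition curvature_tensor_eq0 : Prop :=
  forall u, frame_bundle u -> forall X Y Z, curvature_tensor u X Y Z = 0.

Definition torsion_form_eq0 : Prop :=
  forall X Y, frame_vector_field X -> frame_vector_field Y ->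
  forall u, frame_bundle u -> torsion_form X Y u = 0.

Definition curvature_form_eq0 : Prop :=
  forall X Y, frame_vector_field X -> frame_vector_field Y ->
  forall u, frame_bundle u -> curvature_form X Y u = 0.

End PrincipalConnection.

(* Main.v *)
Require Import Defs.
From HB Require Import structures.
From mathcomp Require Import all_boot all_order all_algebra.
From mathcomp Require Import all_classical all_reals all_analysis.
From mathcomp Require Import ring lra.
Set Implicit Arguments.
Unset Strict Implicit.
Unset Printing Implicit Defensive.
Import Order.TTheory GRing.Theory Num.Theory.
Import numFieldNormedType.Exports.
Local Open Scope classical_set_scope.
Local Open Scope ring_scope.

(** In the global chart the alpha-connection reads
    [nabla_A B = D_A B + omega(A) B]: the defining formula of [<nabla_A B, C>] is
    expanded by linearity of the expectation and solved with the Fisher matrix,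
    and the resulting coefficients are symmetric because second derivatives of
    the log-likelihood commute (Schwarz). On [params * GL(n)] a horizontal vector
    over [a] at [(v, phi)] is [(a, - omega_v(a) phi)], so that
    - along a horizontal lift, [(phi^-1 gamma')' = phi^-1 nabla_{gamma'} gamma'];
    - [Theta(X, Y) = phi^-1 (omega(X) Y - omega(Y) X)], which vanishes by symmetry,
      as does the torsion of [nabla];
    - [Omega(X, Y) = phi^-1 K(X, Y) phi] with [K = d omega + omega /\ omega], while
      the curvature of [nabla] is [K(X, Y) Z], so both vanish exactly when [K]
      does. *)

(** * Directional derivatives *)

(** Derivability and the value of the derivative become one limit of difference quotients, so both
    are transported at once. *)
Lemma is_deriveP (R : realType) (V W : normedModType R) (f : V -> W) x v (df : W) :
  is_derive x v f df <->
  (h^-1 *: (f (h *: v + x) - f x)) @[h --> 0^'] --> df.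
Proof.
split=> [[dfx <-]//|fdf].
by apply: DeriveDef; [apply/cvg_ex; exists df|exact: cvg_lim fdf].
Qed.

Section DirectionalDerivative.
Context {R : realType} {V : normedModType R}.
Implicit Types (x u v : V).

(** The two difference quotients are the same function of [h], because [h *: 1 = h]. This opens
    directional derivatives to the mean value theorem and the one-variable chain rule. *)
Lemma is_derive_line (W : normedModType R) (f : V -> W) x v (t : R) (df : W) :
  is_derive (t *: v + x) v f df <-> is_derive t 1 (fun h => f (h *: v + x)) df.
Proof.
apply: (iff_trans (is_deriveP _ _ _ _)); apply: iff_sym.
apply: (iff_trans (is_deriveP _ _ _ _)).
have E : (fun h => h^-1 *: (f (h *: v + (t *: v + x)) - f (t *: v + x))) =
  (fun h : R => h^-1 *: (f ((h *: (1 : R) + t) *: v + x) - f (t *: v + x))).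
  by apply/funext => h; rewrite [h *: 1]mulr1 scalerDl addrA.
by rewrite E; split.
Qed.

Lemma is_derive_pair (W1 W2 : normedModType R) (f : V -> W1) (g : V -> W2) x v
    df dg : is_derive x v f df -> is_derive x v g dg ->
  is_derive x v (fun y => (f y, g y)) (df, dg).
Proof.
move=> /is_deriveP hf /is_deriveP hg; apply/is_deriveP.
exact: (cvg_pair hf hg).
Qed.

Lemma is_derive_fst (W1 W2 : normedModType R) (f : V -> W1 * W2) x v df :
  is_derive x v f df -> is_derive x v (fun y => (f y).1) df.1.
Proof.
move=> /is_deriveP hf; apply/is_deriveP.
exact: (cvg_comp _ _ hf (@cvg_fst _ _ (nbhs df.1) (nbhs df.2) _)).
Qed.

Lemma is_derive_snd (W1 W2 : normedModType R) (f : V -> W1 * W2) x v df :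
  is_derive x v f df -> is_derive x v (fun y => (f y).2) df.2.
Proof.
move=> /is_deriveP hf; apply/is_deriveP.
exact: (cvg_comp _ _ hf (@cvg_snd _ _ (nbhs df.1) (nbhs df.2) _)).
Qed.

Lemma is_derive_bigsum (W : normedModType R) n (h : 'I_n -> V -> W) x v
    (dh : 'I_n -> W) : (forall i, is_derive x v (h i) (dh i)) ->
  is_derive x v (fun y => \sum_i h i y) (\sum_i dh i).
Proof.
move=> hi; rewrite (_ : (fun y => _) = \sum_i h i); first exact: is_derive_sum.
by apply/funext => y; rewrite fct_sumE.
Qed.

Lemma is_derive_mul (f g : V -> R) x v df dg :
  is_derive x v f df -> is_derive x v g dg ->
  is_derive x v (fun y => f y * g y) (df * g x + f x * dg).
Proof.
move=> hf hg; apply: is_derive_eq (is_deriveM hf hg) _.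
by rewrite addrC [g x *: _]mulrC.
Qed.

Lemma is_derive_ln (f : V -> R) x v df : 0 < f x -> is_derive x v f df ->
  is_derive x v (fun y => ln (f y)) (df / f x).
Proof.
move=> fx0; rewrite -{1 2}[x]add0r -(scale0r v) => /is_derive_line hf.
apply/is_derive_line; rewrite mulrC.
apply: (@is_derive1_comp _ (@ln R) (fun h => f (h *: v + x))).
by rewrite /= scale0r add0r; exact: is_derive1_ln.
Qed.

Lemma is_derive_mxP m n (M : V -> 'M[R]_(m, n)) x v dM :
  is_derive x v M dM <->
  forall i j, is_derive x v (fun y => M y i j) (dM i j).
Proof.
split=> [[hM <-] i j|hM].
  by apply: DeriveDef; [exact: (derivable_mxP _ _ _).1|rewrite derive_mx// mxE].
have dM' : derivable M x v.
  by apply/derivable_mxP => i j; have [] := hM i j.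
apply: DeriveDef => //; rewrite derive_mx//; apply/matrixP => i j.
by rewrite mxE; have [] := hM i j.
Qed.

Lemma is_derive_mulmx m n p (A : V -> 'M[R]_(m, n)) (B : V -> 'M[R]_(n, p))
    x v dA dB : is_derive x v A dA -> is_derive x v B dB ->
  is_derive x v (fun y => A y *m B y) (dA *m B x + A x *m dB).
Proof.
move=> /is_derive_mxP hA /is_derive_mxP hB; apply/is_derive_mxP => i j.
rewrite (_ : (fun y => _) = fun y => \sum_k A y i k * B y k j); last first.
  by apply/funext => y; rewrite mxE.
rewrite !mxE -big_split /=; apply: is_derive_bigsum => k.
exact: is_derive_mul.
Qed.

Lemma derivable_prod (I : Type) (r : seq I) (f : I -> V -> R) x v :
  (forall i, derivable (f i) x v) -> derivable (fun y => \prod_(i <- r) f i y) x v.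
Proof.
move=> hf; elim: r => [|i r ih].
  rewrite (_ : (fun y => _) = cst 1); first exact: derivable_cst.
  by apply/funext => y; rewrite big_nil.
rewrite (_ : (fun y => _) = f i * (fun y => \prod_(i <- r) f i y)).
  exact: derivableM.
by apply/funext => y; rewrite big_cons.
Qed.

Lemma derivable_finsum (I : Type) (r : seq I) (f : I -> V -> R) x v :
  (forall i, derivable (f i) x v) -> derivable (fun y => \sum_(i <- r) f i y) x v.
Proof.
move=> hf; elim: r => [|i r ih].
  rewrite (_ : (fun y => _) = cst 0); first exact: derivable_cst.
  by apply/funext => y; rewrite big_nil.
rewrite (_ : (fun y => _) = f i + (fun y => \sum_(i <- r) f i y)).
  exact: derivableD.
by apply/funext => y; rewrite big_cons.
Qed.

(** By the Leibniz formula the determinant is a finite sum of products of entries. *)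
Lemma derivable_det n (M : V -> 'M[R]_n) x v :
  (forall i j, derivable (fun y => M y i j) x v) ->
  derivable (fun y => \det (M y)) x v.
Proof.
move=> hM; apply: derivable_finsum => s.
by apply: derivableM; [exact: derivable_cst|exact: derivable_prod].
Qed.

Lemma derivable_cofactor n (M : V -> 'M[R]_n) x v i j :
  (forall i j, derivable (fun y => M y i j) x v) ->
  derivable (fun y => cofactor (M y) i j) x v.
Proof.
move=> hM; apply: derivableM; first exact: derivable_cst.
apply: derivable_det => k l.
by rewrite (_ : (fun y => _) = fun y => M y (lift i k) (lift j l));
  [exact: hM|apply/funext => y; rewrite !mxE].
Qed.

(** Derivability comes from Cramer's formula; the value then follows by differentiating
    [M *m invmx M = 1]. *)
Lemma is_derive_invmx n (M : V -> 'M[R]_n) x v dM :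
  (\near x, M x \in unitmx) -> is_derive x v M dM ->
  is_derive x v (fun y => invmx (M y)) (- (invmx (M x) *m dM *m invmx (M x))).
Proof.
move=> hU hM; have Ux := nbhs_singleton hU.
have dM' i j : derivable (fun y => M y i j) x v.
  by move: i j; apply/derivable_mxP; have [] := hM.
have dV : derivable (fun y => invmx (M y)) x v.
  (* [invmx] is given by the adjugate only on invertible matrices, so the replacement is made near
     [x]. *)
  apply: (@near_eq_derivable _ _ _ (fun y => (\det (M y))^-1 *: \adj (M y))).
    by apply: filterS hU => y Uy; rewrite /invmx Uy.
  apply/derivable_mxP => i j.
  rewrite (_ : (fun y => _) =
    (fun y => (\det (M y))^-1) * (fun y => cofactor (M y) j i)); last first.
    by apply/funext => y; rewrite !mxE.
  apply: derivableM; last exact: derivable_cofactor.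
  apply: derivableV; last exact: derivable_det.
  by move: Ux; rewrite unitmxE unitfE.
apply: DeriveDef => //; move/derivableP: dV; set D := derive _ _ _ => hD.
have hV : is_derive x v (fun y => M y *m invmx (M y)) 0.
  apply: (@near_eq_is_derive _ _ _ (cst 1%:M)).
  by apply: filterS hU => y Uy; rewrite mulmxV.
have := is_derive_mulmx hM hD.
move=> /@derive_val; rewrite (@derive_val _ _ _ _ _ _ _ hV) => /esym/eqP.
rewrite addr_eq0 => /eqP h; apply/esym.
by rewrite -[RHS](mulKmx Ux) -[M x *m D]opprK -h mulmxN mulmxA.
Qed.

End DirectionalDerivative.

(** * Symmetry of second derivatives *)

Section Schwarz.
Context {R : realType} {V : normedModType R}.

(** The mean value theorem is used twice: along [u] for the difference [g] of [f] on two opposite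
    sides of the parallelogram, then along [v] for [fu] at the abscissa [a] so found. *)
Lemma second_difference (f fu fuv : V -> R) (x u v : V) (r : R) : 0 < r ->
  (forall a b, 0 <= a <= r -> 0 <= b <= r ->
     is_derive (a *: u + (b *: v + x)) u f (fu (a *: u + (b *: v + x))) /\
     is_derive (a *: u + (b *: v + x)) v fu (fuv (a *: u + (b *: v + x)))) ->
  exists a b, [/\ 0 <= a <= r, 0 <= b <= r &
    f (r *: u + (r *: v + x)) - f (r *: u + x) - f (r *: v + x) + f x =
    fuv (a *: u + (b *: v + x)) * r * r].
Proof.
move=> r0 H; have r1 : 0 <= r <= r by rewrite lexx ltW.
have r2 : (0 : R) <= 0 <= r by rewrite lexx ltW.
pose g s := f (s *: u + (r *: v + x)) - f (s *: u + x).
pose dg s := fu (s *: u + (r *: v + x)) - fu (s *: u + x).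
have hg s : 0 <= s <= r -> is_derive s 1 g (dg s).
  move=> hs; have [+ _] := H s r hs r1; have [+ _] := H s 0 hs r2.
  rewrite scale0r add0r => /is_derive_line h0 /is_derive_line hr.
  exact: is_deriveB hr h0.
have [| |a ha] := @MVT _ g dg 0 r r0.
- by move=> s /[!in_itv]/= /andP[/ltW s0 /ltW sr]; apply: hg; rewrite s0.
- apply: derivable_within_continuous => s /[!in_itv]/= hs.
  by have [] := hg s hs.
rewrite subr0 {1 2}/g !scale0r !add0r => e1.
have {}ha : 0 <= a <= r.
  by move: ha; rewrite in_itv /= => /andP[/ltW -> /ltW ->].
pose k s := fu (a *: u + (s *: v + x)).
pose dk s := fuv (a *: u + (s *: v + x)).
have hk s : 0 <= s <= r -> is_derive s 1 k (dk s).
  move=> hs; rewrite /k /dk [a *: u + (s *: v + x)]addrCA.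
  rewrite (_ : (fun s => _) = fun s => fu (s *: v + (a *: u + x))).
    have [_ h] := H a s ha hs.
    by rewrite [a *: u + (s *: v + x)]addrCA in h; move/is_derive_line: h.
  by apply/funext => t; rewrite addrCA.
have [| |b hb] := @MVT _ k dk 0 r r0.
- by move=> s /[!in_itv]/= /andP[/ltW s0 /ltW sr]; apply: hk; rewrite s0.
- apply: derivable_within_continuous => s /[!in_itv]/= hs.
  by have [] := hk s hs.
rewrite subr0 {1 2}/k scale0r add0r => e2.
exists a, b; split=> //.
  by move: hb; rewrite in_itv /= => /andP[/ltW -> /ltW ->].
rewrite -/(dk b) -e2 -/(dg a) -e1; ring.
Qed.

(** The second difference is symmetric in [u] and [v], so on a small parallelogram [fuv] and [fvu]
    take a common value, at two possibly different points near [x]; continuity at [x] concludes. *)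
Lemma is_derive_schwarz (U : set V) (f fu fv fuv fvu : V -> R) (x u v : V) :
  open U -> U x ->
  (forall y, U y -> is_derive y u f (fu y)) ->
  (forall y, U y -> is_derive y v f (fv y)) ->
  (forall y, U y -> is_derive y v fu (fuv y)) ->
  (forall y, U y -> is_derive y u fv (fvu y)) ->
  {for x, continuous fuv} -> {for x, continuous fvu} ->
  fuv x = fvu x.
Proof.
move=> oU Ux hu hv huv hvu cuv cvu.
apply/eqP; rewrite -subr_eq0 -normr_le0; apply/ler_addgt0Pr => e e0.
rewrite add0r.
have e20 : 0 < e / 2 by rewrite divr_gt0.
have : \forall y \near x, [/\ U y, `|fuv x - fuv y| < e / 2 &
    `|fvu x - fvu y| < e / 2].
  have h1 := open_nbhs_nbhs (conj oU Ux).
  move/cvgrPdist_lt: cuv => /(_ _ e20) h2.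
  move/cvgrPdist_lt: cvu => /(_ _ e20) h3.
  by near=> y; split; near: y.
move=> /nbhs_ballP[del /= del0 hb].
(* With [r = del / c] the parallelogram of side factors [r] stays in the ball of radius [del]; the
   summand 1 makes [c] positive and the bound strict. *)
pose c := 1 + `|u| + `|v|.
have c0 : 0 < c by rewrite /c -addrA ltr_pwDl// addr_ge0.
pose r := del / c; have r0 : 0 < r by rewrite divr_gt0.
have small a b : 0 <= a <= r -> 0 <= b <= r -> 
    ball x del (a *: u + (b *: v + x)).
  move=> /andP[a0 ar] /andP[b0 br]; rewrite -ball_normE /ball_ /=.
  rewrite addrA opprD addrCA subrr addr0 normrN.
  apply: le_lt_trans (ler_normD _ _) _; rewrite !normrZ !ger0_norm//.
  apply: (@le_lt_trans _ _ (r * `|u| + r * `|v|)).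
    by rewrite lerD// ler_wpM2r.
  rewrite -mulrDr -[ltRHS](divfK (lt0r_neq0 c0)) -/r ltr_pM2l// /c; lra.
have [a [b [ha hb1 E1]]] : exists a b, [/\ 0 <= a <= r, 0 <= b <= r &
    f (r *: u + (r *: v + x)) - f (r *: u + x) - f (r *: v + x) + f x =
    fuv (a *: u + (b *: v + x)) * r * r].
  apply: (@second_difference f fu) => // a b ha hb1.
  by have [/[dup] /hu ? /huv ?] := hb _ (small _ _ ha hb1).
have [b' [a' [hb' ha' E2]]] : exists a b, [/\ 0 <= a <= r, 0 <= b <= r &
    f (r *: v + (r *: u + x)) - f (r *: v + x) - f (r *: u + x) + f x =
    fvu (a *: v + (b *: u + x)) * r * r].
  apply: (@second_difference f fv) => // b1 a1 hb1' ha1; rewrite addrCA.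
  by have [/[dup] /hv ? /hvu ?] := hb _ (small _ _ ha1 hb1').
rewrite addrCA [b' *: v + _]addrCA in E2.
have [_ + _] := hb _ (small _ _ ha hb1).
have [_ _] := hb _ (small _ _ ha' hb').
have -> : fuv (a *: u + (b *: v + x)) = fvu (a' *: u + (b' *: v + x)).
  apply/(mulIf (lt0r_neq0 r0))/(mulIf (lt0r_neq0 r0)).
  by rewrite -E1 -E2; ring.
rewrite ler_norml !ltr_norml => /andP[? ?] /andP[? ?].
by apply/andP; split; lra.
Unshelve. all: by end_near. Qed.

End Schwarz.

(** * Smooth functions and the log-likelihood *)

Section SmoothFunctions.
Context {R : realType} {V W : normedModType R}.
Implicit Types (U : set V) (f : V -> W).

Lemma smooth_on_differentiable U f x :
  smooth_on U f -> U x -> differentiable f x.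
Proof. by move=> sf; have [h _] := sf 1%N; exact: h. Qed.

Lemma smooth_on_derive U f v : smooth_on U f -> smooth_on U ('D_v f).
Proof. by move=> sf k; have [_] := sf k.+1; exact. Qed.

Lemma smooth_on_cst U (w : W) : smooth_on U (cst w : V -> W).
Proof.
move=> k; elim: k w => [|k ih] w /=; first by move=> x _; exact: cst_continuous.
split=> [x _|v]; first exact: differentiable_cst.
rewrite (_ : 'D_v (cst w) = cst 0); first exact: ih.
by apply/funext => x; rewrite derive_cst.
Qed.

Lemma smooth_on_is_derive U f x v :
  smooth_on U f -> U x -> is_derive x v f ('D_v f x).
Proof.
by move=> sf Ux; apply/derivableP/diff_derivable/(smooth_on_differentiable sf).
Qed.

Lemma deriveB_dir f x u v : differentiable f x ->
  'D_(u - v) f x = 'D_u f x - 'D_v f x.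
Proof. by move=> df; rewrite !deriveE// linearB. Qed.

End SmoothFunctions.

(** Differentiability makes ['D_a f x] linear in the direction [a]. *)
Lemma derive_basis (R : realType) (W : normedModType R) n (f : 'cV[R]_n -> W)
    x a : differentiable f x ->
  'D_a f x = \sum_i a i 0 *: 'D_(basis_vec i) f x.
Proof.
move=> df; rewrite deriveE//.
rewrite {1}(_ : a = \sum_i a i 0 *: basis_vec i); last first.
  rewrite [LHS]matrix_sum_delta; apply: eq_bigr => i _.
  by rewrite big_ord1.
by rewrite linear_sum; apply: eq_bigr => i _; rewrite linearZ deriveE.
Qed.

(** Entrywise Schwarz. This version serves vector fields, the real-valued one below serves
    densities. *)
Lemma smooth_on_schwarz (R : realType) (V : normedModType R) m n (U : set V)
    (f : V -> 'M[R]_(m, n)) x u v : open U -> smooth_on U f -> U x ->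
  'D_v ('D_u f) x = 'D_u ('D_v f) x.
Proof.
move=> oU sf Ux; apply/matrixP => i j.
have coord w (g : V -> 'M[R]_(m, n)) y : smooth_on U g -> U y ->
    is_derive y w (fun z => g z i j) ('D_w g y i j).
  by move=> sg Uy; apply: (is_derive_mxP _ _ _ _).1; exact: smooth_on_is_derive sg Uy.
have cont (g : V -> 'M[R]_(m, n)) : smooth_on U g ->
    {for x, continuous (fun z => g z i j)}.
  move=> sg; apply: (@continuous_comp _ _ _ g (fun M : 'M[R]_(m, n) => M i j)).
    exact/differentiable_continuous/(smooth_on_differentiable sg).
  exact: coord_continuous.
apply: (@is_derive_schwarz _ _ U (fun z => f z i j) (fun z => 'D_u f z i j)
  (fun z => 'D_v f z i j) (fun z => 'D_v ('D_u f) z i j)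
  (fun z => 'D_u ('D_v f) z i j) x u v) => // [y|y|y|y||].
- exact: coord.
- exact: coord.
- exact/coord/smooth_on_derive.
- exact/coord/smooth_on_derive.
- exact/cont/smooth_on_derive/smooth_on_derive.
- exact/cont/smooth_on_derive/smooth_on_derive.
Qed.

Lemma smooth_on_schwarz_real (R : realType) (V : normedModType R) (U : set V)
    (f : V -> R) x u v : open U -> smooth_on U f -> U x ->
  'D_v ('D_u f) x = 'D_u ('D_v f) x.
Proof.
move=> oU sf Ux.
apply: (@is_derive_schwarz _ _ U f ('D_u f) ('D_v f) ('D_v ('D_u f))
  ('D_u ('D_v f)) x u v) => // [y|y|y|y||].
- exact: smooth_on_is_derive.
- exact: smooth_on_is_derive.
- exact/smooth_on_is_derive/smooth_on_derive.
- exact/smooth_on_is_derive/smooth_on_derive.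
- exact: (smooth_on_derive _ (smooth_on_derive _ sf) 0%N).
- exact: (smooth_on_derive _ (smooth_on_derive _ sf) 0%N).
Qed.

Section Loglikelihood.
Context {R : realType} {d : measure_display} {T : measurableType d}.
Context {mu : {measure set T -> \bar R}} {n : nat}.
Variable S : stat_manifold mu n.
Implicit Types (v a : 'cV[R]_n) (A B C : 'cV[R]_n -> 'cV[R]_n).
Local Notation p := (dens S).

Lemma params_near v : params S v -> \forall w \near v, params S w.
Proof. by move=> Sv; apply: open_nbhs_nbhs; split=> //; exact: params_open. Qed.

Lemma is_derive_dens x v a : params S v ->
  is_derive v a (p ^~ x) ('D_a (p ^~ x) v).
Proof. exact/smooth_on_is_derive/dens_smooth. Qed.

Lemma is_derive_loglik x v a : params S v ->
  is_derive v a (loglik p x) ('D_a (p ^~ x) v / p v x).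
Proof.
move=> Sv; apply: (@is_derive_ln _ _ (p ^~ x)); first exact: dens_gt0.
exact: is_derive_dens.
Qed.

Lemma derive_loglik x v a : params S v ->
  'D_a (loglik p x) v = \sum_i a i 0 * dloglik p i v x.
Proof.
move=> Sv; have [_ ->] := is_derive_loglik x a Sv.
rewrite derive_basis; last exact: smooth_on_differentiable (dens_smooth S x) Sv.
rewrite mulr_suml; apply: eq_bigr => i _; rewrite /dloglik.
by have [_ ->] := is_derive_loglik x (basis_vec i) Sv; rewrite -mulrA.
Qed.

(** Smoothness is given for the densities, so near [v] the score is rewritten as the quotient of
    ['D_(basis_vec i) p] by [p] and the quotient rule applies. *)
Lemma is_derive_dloglik i x v a : params S v ->
  is_derive v a (fun w => dloglik p i w x)
    ('D_a ('D_(basis_vec i) (p ^~ x)) v / p v x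
     - 'D_(basis_vec i) (p ^~ x) v * 'D_a (p ^~ x) v / p v x ^+ 2).
Proof.
move=> Sv; have p0 := lt0r_neq0 (dens_gt0 x Sv).
apply: (@near_eq_is_derive _ _ _
    (fun w => 'D_(basis_vec i) (p ^~ x) w * (p w x)^-1)).
  near=> w; have Sw : params S w by near: w; exact: params_near.
  by have [_ <-] := is_derive_loglik x (basis_vec i) Sw.
have dV : is_derive v a (fun w => (p w x)^-1) (- (p v x) ^- 2 *: 'D_a (p ^~ x) v).
  have [dp _] := is_derive_dens x a Sv.
  by apply: DeriveDef; [exact: derivableV|exact: (deriveV p0)].
have sD := smooth_on_derive (basis_vec i) (dens_smooth S x).
apply: is_derive_eq (is_derive_mul (smooth_on_is_derive a sD Sv) dV) _.
by rewrite scaleNr mulrN [_ *: _]mulrC mulrA.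
Unshelve. all: by end_near. Qed.

Lemma derive_dloglik j x v a : params S v ->
  'D_a (fun w => dloglik p j w x) v = \sum_i a i 0 * d2loglik p i j v x.
Proof.
move=> Sv; have [_ ->] := is_derive_dloglik j x a Sv.
have sD := smooth_on_derive (basis_vec j) (dens_smooth S x).
rewrite !(derive_basis a); [|exact: smooth_on_differentiable (dens_smooth S x) Sv|
  exact: smooth_on_differentiable sD Sv].
rewrite mulr_sumr !mulr_suml -sumrB; apply: eq_bigr => i _; rewrite /d2loglik.
have [_ ->] := is_derive_dloglik j x (basis_vec i) Sv.
rewrite /GRing.scale/=; ring.
Qed.

(** In the quotient rule formula the leading term is symmetric by Schwarz for the density, the
    product of first derivatives by commutativity. *)
Lemma d2loglikC i j x v : params S v ->
  d2loglik p i j v x = d2loglik p j i v x.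
Proof.
move=> Sv; rewrite /d2loglik.
have [_ ->] := is_derive_dloglik j x (basis_vec i) Sv.
have [_ ->] := is_derive_dloglik i x (basis_vec j) Sv.
rewrite [in RHS](smooth_on_schwarz_real _ _ (@params_open _ _ _ _ _ S) (dens_smooth S x) Sv).
by rewrite [X in _ - X / _]mulrC.
Qed.

(** Leibniz rule for [B^j d_j l]. Of [B] only a derivative along [A v] at [v] is asked, so that [B]
    may itself be a covariant derivative when the curvature is computed. *)
Lemma vf_act_vf_act_loglik A B x v DB : params S v ->
  is_derive v (A v) B DB ->
  vf_act A (vf_act B (loglik p x)) v =
  \sum_j (DB j 0 * dloglik p j v x +
          \sum_i A v i 0 * B v j 0 * d2loglik p i j v x).
Proof.
move=> Sv /is_derive_mxP dB; rewrite /vf_act.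
apply: (@derive_val _ _ _ v (A v)).
apply: (@near_eq_is_derive _ _ _ (fun w => \sum_j B w j 0 * dloglik p j w x)).
  near=> w; rewrite -derive_loglik//; near: w; exact: params_near.
apply: is_derive_bigsum => j.
have [dl _] := is_derive_dloglik j x (A v) Sv.
apply: is_derive_eq (is_derive_mul (dB j 0) (derivableP dl)) _.
rewrite derive_dloglik// mulr_sumr; congr (_ + _); apply: eq_bigr => i _; ring.
Unshelve. all: by end_near. Qed.

End Loglikelihood.

(** * Linearity of the expectation *)

Section Expectation.
Context {R : realType} {d : measure_display} {T : measurableType d}.
Context {mu : {measure set T -> \bar R}} {n : nat}.
Variables (p : 'cV[R]_n -> T -> R) (v : 'cV[R]_n).

(** Integrability travels with the value, since additivity of the integral requires it of each
    summand. *)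
Definition has_expect (f : T -> R) (e : R) : Prop :=
  mu.-integrable setT (fun x => (f x * p v x)%:E) /\ expect mu p v f = e.

Lemma has_expectD f g e e' : has_expect f e -> has_expect g e' ->
  has_expect (fun x => f x + g x) (e + e').
Proof.
move=> [If <-] [Ig <-]; rewrite /has_expect /expect.
rewrite (_ : (fun x => ((f x + g x) * p v x)%:E) =
  (fun x => (f x * p v x)%:E + (g x * p v x)%:E)%E); last first.
  by apply/funext => x; rewrite mulrDl EFinD.
split; first exact: integrableD.
rewrite -RintegralD//; apply: eq_Rintegral => x _; exact: mulrDl.
Qed.

Lemma has_expectZ (k : R) f e : has_expect f e ->
  has_expect (fun x => k * f x) (k * e).
Proof.
move=> [If <-]; rewrite /has_expect /expect.
rewrite (_ : (fun x => (k * f x * p v x)%:E) =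
  (fun x => k%:E * (f x * p v x)%:E)%E); last first.
  by apply/funext => x; rewrite -mulrA EFinM.
split; first exact: integrableZl.
rewrite -RintegralZl//; apply: eq_Rintegral => x _; exact/esym/mulrA.
Qed.

Lemma has_expect0 : has_expect (fun=> 0) 0.
Proof.
rewrite /has_expect /expect.
rewrite (_ : (fun x => (0 * p v x)%:E) = (fun=> 0%E)); last first.
  by apply/funext => x; rewrite mul0r.
split; first exact: integrable0.
under eq_Rintegral do rewrite mul0r.
by rewrite Rintegral_cst// mul0r.
Qed.

Lemma has_expect_sum (I : Type) (r : seq I) (f : I -> T -> R) (e : I -> R) :
  (forall i, has_expect (f i) (e i)) ->
  has_expect (fun x => \sum_(i <- r) f i x) (\sum_(i <- r) e i).
Proof.
move=> fe; elim: r => [|i r ih].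
  rewrite big_nil (_ : (fun x => _) = fun=> 0); first exact: has_expect0.
  by apply/funext => x; rewrite big_nil.
rewrite big_cons (_ : (fun x => _) = fun x => f i x + \sum_(i <- r) f i x).
  exact: has_expectD.
by apply/funext => x; rewrite big_cons.
Qed.

End Expectation.

(** * The alpha-connection in coordinates *)

(** Used to read the coefficients [Gamma] off the general formula for nabla at coordinate fields. *)
Lemma bilinear_basis (R : realType) (W : lmodType R) n (F : 'I_n -> 'I_n -> W) i j :
  \sum_j' \sum_i' (basis_vec (R := R) i i' 0 * basis_vec j j' 0) *: F i' j' = F i j.
Proof.
rewrite (bigD1 j)//= (bigD1 i)//= !mxE !eqxx mul1r scale1r.
rewrite big1 => [|i' /negPf ii']; last by rewrite !mxE ii' mul0r scale0r.
rewrite addr0 big1 ?addr0// => j' /negPf jj'; rewrite big1// => i' _.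
by rewrite !mxE jj' mulr0 scale0r.
Qed.

Section AlphaConnectionCoefficients.
Context {R : realType} {d : measure_display} {T : measurableType d}.
Context {mu : {measure set T -> \bar R}} {n : nat}.
Variables (S : stat_manifold mu n) (alpha : R).
Implicit Types (v a b : 'cV[R]_n) (A B C : 'cV[R]_n -> 'cV[R]_n).
Local Notation p := (dens S).
Local Notation G := (fisher_mx mu p).

(* [<nabla_{d_i} d_j, d_k>]; [gamma_up] raises the index [k]. *)
Definition gamma_low (i j k : 'I_n) v : R :=
  expect mu p v (fun x => d2loglik p i j v x * dloglik p k v x) +
  (1 - alpha) / 2 * expect mu p v
    (fun x => dloglik p i v x * dloglik p j v x * dloglik p k v x).

Definition gamma_up (i j : 'I_n) v : 'cV[R]_n :=
  invmx (G v)^T *m \col_k gamma_low i j k v.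

(** Both integrands are expanded pointwise into coordinate products with coefficients constant in
    [x], and the expectation is taken term by term. The derivative of [B] pairs with the metric; the
    remaining terms combine into [gamma_low]. *)
Lemma alpha_rhsE A B C v DB : params S v -> is_derive v (A v) B DB ->
  alpha_rhs S alpha A B C v =
  \sum_k C v k 0 * (\sum_j DB j 0 * G v j k +
    \sum_j \sum_i A v i 0 * B v j 0 * gamma_low i j k v).
Proof.
move=> Sv dB; rewrite /alpha_rhs.
have has_dd i j : has_expect (mu := mu) p v
    (fun x => dloglik p i v x * dloglik p j v x) (G v i j).
  by split; [have [h _] := expect_dd S i j; exact: h|rewrite mxE].
have has_d2d i j k : has_expect (mu := mu) p v
    (fun x => d2loglik p i j v x * dloglik p k v x)
    (expect mu p v (fun x => d2loglik p i j v x * dloglik p k v x)).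
  by split; [have [h _] := expect_d2d S i j k; exact: h|].
have has_ddd i j k : has_expect (mu := mu) p v
    (fun x => dloglik p i v x * dloglik p j v x * dloglik p k v x)
    (expect mu p v (fun x => dloglik p i v x * dloglik p j v x * dloglik p k v x)).
  by split; [have [h _] := expect_ddd S i j k; exact: h|].
set f1 := fun x => _; set f2 := fun x : T => _ * _ * _.
have -> : f1 = fun x => \sum_k C v k 0 *
    (\sum_j DB j 0 * (dloglik p j v x * dloglik p k v x) +
     \sum_j \sum_i A v i 0 * B v j 0 * (d2loglik p i j v x * dloglik p k v x)).
  apply/funext => x; rewrite /f1 (vf_act_vf_act_loglik _ Sv dB).
  rewrite {1}/vf_act derive_loglik// mulr_sumr; apply: eq_bigr => k _.
  rewrite mulrCA mulr_suml -big_split /=; congr (_ * _); apply: eq_bigr => j _.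
  by rewrite mulrDl -mulrA mulr_suml; congr (_ + _); apply: eq_bigr => i _;
    rewrite !mulrA.
have -> : f2 = fun x => \sum_k C v k 0 * \sum_j \sum_i A v i 0 * B v j 0 *
     (dloglik p i v x * dloglik p j v x * dloglik p k v x).
  apply/funext => x; rewrite /f2 /vf_act !derive_loglik// mulr_sumr.
  apply: eq_bigr => k _; rewrite mulrCA; congr (_ * _).
  rewrite mulr_sumr mulr_suml.
  by apply: eq_bigr => j _; rewrite !mulr_suml; apply: eq_bigr => i _;
    rewrite mulrACA -mulrA.
have [_ ->] : has_expect (mu := mu) p v (fun x => \sum_k C v k 0 *
    (\sum_j DB j 0 * (dloglik p j v x * dloglik p k v x) +
     \sum_j \sum_i A v i 0 * B v j 0 * (d2loglik p i j v x * dloglik p k v x)))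
    (\sum_k C v k 0 * (\sum_j DB j 0 * G v j k + \sum_j \sum_i A v i 0 * B v j 0 *
      expect mu p v (fun x => d2loglik p i j v x * dloglik p k v x))).
  apply: has_expect_sum => k; apply: has_expectZ; apply: has_expectD.
    by apply: has_expect_sum => j; apply: has_expectZ; exact: has_dd.
  apply: has_expect_sum => j; apply: has_expect_sum => i; apply: has_expectZ.
  exact: has_d2d.
have [_ ->] : has_expect (mu := mu) p v (fun x => \sum_k C v k 0 *
    \sum_j \sum_i A v i 0 * B v j 0 *
     (dloglik p i v x * dloglik p j v x * dloglik p k v x))
    (\sum_k C v k 0 * \sum_j \sum_i A v i 0 * B v j 0 *
      expect mu p v (fun x => dloglik p i v x * dloglik p j v x * dloglik p k v x)).
  apply: has_expect_sum => k; apply: has_expectZ.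
  apply: has_expect_sum => j; apply: has_expect_sum => i; apply: has_expectZ.
  exact: has_ddd.
rewrite mulr_sumr -big_split /=; apply: eq_bigr => k _.
rewrite mulrCA -mulrDr -addrA; congr (_ * (_ + _)).
rewrite mulr_sumr -big_split /=; apply: eq_bigr => j _.
rewrite mulr_sumr -big_split /=; apply: eq_bigr => i _.
by rewrite /gamma_low mulrDr; congr (_ + _); rewrite mulrCA.
Qed.

(** Puts the metric in the shape of [alpha_rhsE], a sum over the components of the second argument,
    so that the two compare coefficientwise. *)
Lemma fisher_dotE v a b :
  fisher_dot mu p v a b = \sum_k b k 0 * ((G v)^T *m a) k 0.
Proof.
rewrite /fisher_dot exchange_big /=; apply: eq_bigr => k _.
rewrite mxE mulr_sumr; apply: eq_bigr => i _.
by rewrite !mxE mulrC.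
Qed.

(** Positive definiteness gives nondegeneracy: test against [c = a - b]. *)
Lemma fisher_dot_inj v a b : params S v ->
  (forall c, fisher_dot mu p v a c = fisher_dot mu p v b c) -> a = b.
Proof.
move=> Sv ab; apply/eqP; rewrite -subr_eq0; apply/negPn/negP => ab0.
have := fisher_posdef Sv ab0; rewrite fisher_dotE.
rewrite (_ : \sum_k _ = fisher_dot mu p v a (a - b) - fisher_dot mu p v b (a - b)).
  by rewrite ab subrr ltxx.
rewrite !fisher_dotE -sumrB; apply: eq_bigr => k _.
by rewrite mulmxBr -mulrBr; congr (_ * _); rewrite !mxE.
Qed.

Lemma fisher_mx_unit v : params S v -> (G v)^T \in unitmx.
Proof.
move=> Sv; rewrite unitmx_tr -row_free_unit; apply: inj_row_free => w w0.
rewrite -[w]trmxK; apply/eqP; rewrite trmx_eq0; apply/eqP.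
apply: (fisher_dot_inj Sv) => c; rewrite !fisher_dotE -trmx_mul w0 trmx0 mulmx0.
by [].
Qed.

(** The explicit vector satisfies the condition inside [get], because the transposed Fisher matrix
    lowers [gamma_up] back to [gamma_low]; nondegeneracy identifies it with the chosen one. *)
Lemma alpha_nabla_upE A B v DB : params S v -> is_derive v (A v) B DB ->
  alpha_nabla S alpha A B v =
  DB + \sum_j \sum_i (A v i 0 * B v j 0) *: gamma_up i j v.
Proof.
move=> Sv dB; set w := RHS.
have wP : [set w : 'cV[R]_n | forall C, vector_field S C ->
    fisher_dot mu p v w (C v) = alpha_rhs S alpha A B C v] w.
  move=> C _; rewrite (alpha_rhsE _ Sv dB) fisher_dotE; apply: eq_bigr => k _.
  rewrite /w mulmxDr mxE; congr (_ * (_ + _)).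
    by rewrite mxE; apply: eq_bigr => j _; rewrite !mxE mulrC.
  rewrite mulmx_sumr summxE; apply: eq_bigr => j _.
  rewrite mulmx_sumr summxE; apply: eq_bigr => i _.
  rewrite -scalemxAr /gamma_up mulKVmx ?fisher_mx_unit//.
  by rewrite !mxE.
have gP := getPex (ex_intro _ w wP).
apply: (fisher_dot_inj Sv) => c.
(* Every tangent vector [c] is the value at [v] of a constant field. *)
have sc : vector_field S (cst c) by exact: smooth_on_cst.
by rewrite [LHS](gP _ sc) (wP _ sc).
Qed.

Lemma GammaE k i j v : params S v ->
  Gamma S alpha k i j v = gamma_up i j v k 0.
Proof.
move=> Sv; rewrite /Gamma.
rewrite (alpha_nabla_upE Sv (is_derive_cst _ _ _)) add0r.
by rewrite (bilinear_basis (fun i j => gamma_up i j v)).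
Qed.

(** The Hessian of the log-likelihood is symmetric, and so is the product of the first two scores in
    the cubic term. This is the source of vanishing torsion for every [alpha]. *)
Lemma gamma_lowC i j k v : params S v -> gamma_low i j k v = gamma_low j i k v.
Proof.
move=> Sv.
have E1 : (fun x => d2loglik p i j v x * dloglik p k v x) =
    (fun x => d2loglik p j i v x * dloglik p k v x).
  apply/funext => x.
  exact: (congr1 (fun t => t * dloglik p k v x) (d2loglikC i j x Sv)).
have E2 : (fun x => dloglik p i v x * dloglik p j v x * dloglik p k v x) =
    (fun x => dloglik p j v x * dloglik p i v x * dloglik p k v x).
  apply/funext => x.
  exact: (congr1 (fun t => t * dloglik p k v x)
    (mulrC (dloglik p i v x) (dloglik p j v x))).
exact: (congr2 (fun s t => s + (1 - alpha) / 2 * t)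
  (congr1 (expect mu p v) E1) (congr1 (expect mu p v) E2)).
Qed.

Lemma GammaC k i j v : params S v ->
  Gamma S alpha k i j v = Gamma S alpha k j i v.
Proof.
move=> Sv; apply: etrans (GammaE k i j Sv) _.
apply: etrans _ (esym (GammaE k j i Sv)).
have E : \col_k gamma_low i j k v = \col_k gamma_low j i k v.
  apply/colP => l; apply: etrans (mxE _ _ _ _) _.
  exact: etrans (gamma_lowC i j l Sv) (esym (mxE _ _ _ _)).
exact: (congr1 (fun M : 'cV[R]_n => (invmx (G v)^T *m M) k 0) E).
Qed.

Lemma derivable_Gamma k i j v a : params S v ->
  derivable (Gamma S alpha k i j) v a.
Proof.
move=> Sv.
apply: (@near_eq_derivable _ _ _ (fun w => gamma_up i j w k 0)).
  by apply: filterS (params_near Sv) => w Sw; rewrite (GammaE _ _ _ Sw).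
(* Generalizing over the entry turns the goal into derivability of the whole column [gamma_up], a
   matrix product. *)
move: k (0 : 'I_1); apply/derivable_mxP.
have dG : derivable (fun w => (G w)^T) v a.
  apply/derivable_mxP => k l.
  rewrite (_ : (fun w => _) = fun w => expect mu p w
    (fun x => dloglik p l w x * dloglik p k w x)).
    have [_ h] := expect_dd S l k.
    exact/diff_derivable/(smooth_on_differentiable h).
  by apply/funext => w; rewrite !mxE.
have dl : derivable (fun w => \col_k gamma_low i j k w) v a.
  apply/derivable_mxP => k l.
  rewrite (_ : (fun w => _) = gamma_low i j k); last first.
    by apply/funext => w; rewrite mxE.
  apply: derivableD.
    have [_ h] := expect_d2d S i j k.
    exact/diff_derivable/(smooth_on_differentiable h).
  apply: derivableZ; have [_ h] := expect_ddd S i j k.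
  exact/diff_derivable/(smooth_on_differentiable h).
have Gu : \forall w \near v, (G w)^T \in unitmx.
  by apply: filterS (params_near Sv) => w; exact: fisher_mx_unit.
by have [] := is_derive_mulmx (is_derive_invmx Gu (derivableP dG)) (derivableP dl).
Qed.

Local Notation omega := (conn_local S alpha).

Lemma conn_localC v a b : params S v -> omega v a *m b = omega v b *m a.
Proof.
move=> Sv; apply/colP => k; rewrite !mxE.
under eq_bigr do rewrite mxE mulr_suml.
under [RHS]eq_bigr do rewrite mxE mulr_suml.
rewrite exchange_big /=; apply: eq_bigr => i _; apply: eq_bigr => j _.
by rewrite (GammaC _ j i)// mulrAC.
Qed.

(** [conn_local] contracts the second lower index of [Gamma] with its form argument, whereas nabla
    contracts the first one with the direction; [conn_localC] reconciles the two. *)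
Lemma alpha_nablaE A B v DB : params S v -> is_derive v (A v) B DB ->
  alpha_nabla S alpha A B v = DB + omega v (A v) *m B v.
Proof.
move=> Sv dB; rewrite (alpha_nabla_upE Sv dB) conn_localC//; congr (_ + _).
apply/colP => k; rewrite exchange_big summxE [RHS]mxE /=.
apply: eq_bigr => i _; rewrite summxE [X in _ = X * _]mxE mulr_suml.
apply: eq_bigr => j _; rewrite (GammaE k i j Sv) [LHS]mxE.
by rewrite mulrC mulrA mulrAC.
Qed.

End AlphaConnectionCoefficients.

(** * The frame bundle *)

Lemma det_continuous (R : realType) n : continuous (fun M : 'M[R]_n => \det M).
Proof.
have monomial (c : R) (s : 'I_n -> 'I_n) :
    continuous (fun M : 'M[R]_n => c * \prod_i M i (s i)).
  have h : continuous (fun M : 'M[R]_n => \prod_i M i (s i)).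
    apply: continuous_big => [|i _]; first exact: mul_continuous.
    exact: coord_continuous.
  move=> M.
  exact: (@continuousM R _ (cst c) _ M (@cst_continuous _ _ c _) (h M)).
by apply: continuous_big => [|s _]; [exact: add_continuous|exact: monomial].
Qed.

(** The determinant is continuous, and a singular [N] would have its determinant at distance exactly
    [|\det M|] from that of [M]. *)
Lemma unitmx_near (R : realType) n (M : 'M[R]_n) : M \in unitmx ->
  \forall N \near M, N \in unitmx.
Proof.
rewrite unitmxE unitfE => dM.
have /cvgrPdist_lt/(_ `|\det M|) := @det_continuous R n M.
rewrite normr_gt0 => /(_ dM); apply: filterS => N.
rewrite unitmxE unitfE; apply: contraTneq => ->.
by rewrite subr0 ltxx.
Qed.

Lemma is_derive_scale (R : realType) (V : normedModType R) m n (f : V -> R)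
    (M : V -> 'M[R]_(m, n)) x v df dM :
  is_derive x v f df -> is_derive x v M dM ->
  is_derive x v (fun y => f y *: M y) (df *: M x + f x *: dM).
Proof.
move=> hf /is_derive_mxP hM; apply/is_derive_mxP => i j; rewrite !mxE.
rewrite (_ : (fun y => _) = fun y => f y * M y i j); last first.
  by apply/funext => y; rewrite mxE.
exact: is_derive_mul.
Qed.

(** Product rule with two contributions: the direction frozen at [Y v], and the variation of the
    direction itself. *)
Lemma is_derive_derive (R : realType) n (U : set 'cV[R]_n) m
    (Y : 'cV[R]_n -> 'cV[R]_n) (Z : 'cV[R]_n -> 'cV[R]_m) v a DY :
  open U -> U v -> smooth_on U Z -> is_derive v a Y DY ->
  is_derive v a (fun w => 'D_(Y w) Z w)
    ('D_a ('D_(Y v) Z) v + 'D_DY Z v).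
Proof.
move=> oU Uv sZ.
have expand Y1 DY1 : is_derive v a Y1 DY1 ->
    is_derive v a (fun w => 'D_(Y1 w) Z w)
      (\sum_j (DY1 j 0 *: 'D_(basis_vec j) Z v +
               Y1 v j 0 *: 'D_a ('D_(basis_vec j) Z) v)).
  move=> /is_derive_mxP dY1.
  apply: (@near_eq_is_derive _ _ _
    (fun w => \sum_j Y1 w j 0 *: 'D_(basis_vec j) Z w)).
    have : \forall w \near v, U w by exact: open_nbhs_nbhs.
    apply: filterS => w Uw; apply/esym/derive_basis.
    exact: smooth_on_differentiable sZ Uw.
  apply: is_derive_bigsum => j.
  exact: (is_derive_scale (dY1 j 0)
    (smooth_on_is_derive a (smooth_on_derive (basis_vec j) sZ) Uv)).
move=> dY; apply: is_derive_eq (expand _ _ dY) _; rewrite big_split /= addrC.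
rewrite -derive_basis; last exact: smooth_on_differentiable sZ Uv.
have [_ ->] := expand _ _ (is_derive_cst (Y v) v a).
by congr (_ + _); apply: eq_bigr => j _; rewrite mxE scale0r add0r.
Qed.

(** Here [dXY] stands for the derivative of omega along [X] evaluated on [Y], [wDY] for omega of
    [D_X Y], [wDX] for omega of [D_Y X], and [wL] for omega of the bracket. *)
Lemma curvature_form_algebra (R : realType) n
    (phi dXY dYX wX wY wDY wDX wL : 'M[R]_n) : wL = wDY - wDX ->
  - (wL *m phi +
      (- ((dXY + wDY) *m phi + wY *m - (wX *m phi))
       - - ((dYX + wDX) *m phi + wX *m - (wY *m phi)))) =
  (dXY - dYX + wX *m wY - wY *m wX) *m phi.
Proof.
move=> ->; rewrite !mulmxBl !mulmxDl !mulmxN !mulmxA.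
rewrite !mulNmx; move: (_ *m phi) (_ *m phi) (_ *m phi) (_ *m phi) (_ *m phi)
  (_ *m phi) => a1 a2 a3 a4 a5 a6.
by apply/matrixP => i j; rewrite !mxE; ring.
Qed.

(** Notation as above; [DXDYZ] is a second derivative in frozen directions, [DDYZ] and [DDXZ] are
    derivatives of [Z] along [D_X Y] and [D_Y X], and [DLZ] is the one along the bracket. *)
Lemma curvature_tensor_algebra (R : realType) n
    (dXY dYX wX wY wDY wDX wL : 'M[R]_n)
    (z DXZ DYZ DXDYZ DYDXZ DDYZ DDXZ DLZ : 'cV[R]_n) :
  wL = wDY - wDX -> DXDYZ = DYDXZ -> DLZ = DDYZ - DDXZ ->
  DXDYZ + DDYZ + ((dXY + wDY) *m z + wY *m DXZ) + wX *m (DYZ + wY *m z)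
  - (DYDXZ + DDXZ + ((dYX + wDX) *m z + wX *m DYZ) + wY *m (DXZ + wX *m z))
  - (DLZ + wL *m z) =
  (dXY - dYX + wX *m wY - wY *m wX) *m z.
Proof.
move=> -> -> ->; rewrite !mulmxBl !mulmxDl !mulmxDr !mulmxA !mulNmx.
move: (_ *m z) (_ *m z) (_ *m z) (_ *m z) (_ *m z) (_ *m z)
  (_ *m DXZ) (_ *m DYZ) => a1 a2 a3 a4 a5 a6 a7 a8.
by apply/matrixP => i j; rewrite !mxE; ring.
Qed.

Section FrameBundleGeometry.
Context {R : realType} {d : measure_display} {T : measurableType d}.
Context {mu : {measure set T -> \bar R}} {n : nat}.
Variables (S : stat_manifold mu n) (alpha : R).
Local Notation FT := ('cV[R]_n * 'M[R]_n)%type.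
Local Notation omega := (conn_local S alpha).
Implicit Types (v a b : 'cV[R]_n) (u w : FT).

(* The derivative of [omega] along [a], with its 1-form argument [b] kept fixed. *)
Definition conn_local_derive v a b : 'M[R]_n :=
  \matrix_(k, j) \sum_i 'D_a (Gamma S alpha k j i) v * b i 0.

Local Notation domega := conn_local_derive.

Lemma conn_localB v a b : omega v (a - b) = omega v a - omega v b.
Proof.
apply/matrixP => k j; rewrite !mxE -sumrB; apply: eq_bigr => i _.
by rewrite !mxE mulrBr.
Qed.

(** The base map [q] is left free to cover both the manifold ([q = id]) and the frame bundle
    ([q = fst]). *)
Lemma is_derive_conn_local (V : normedModType R) (q Y : V -> 'cV[R]_n) (x w : V)
    a DY :
  (forall k j i, is_derive x w (fun z => Gamma S alpha k j i (q z))
                   ('D_a (Gamma S alpha k j i) (q x))) ->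
  is_derive x w Y DY ->
  is_derive x w (fun z => omega (q z) (Y z))
    (domega (q x) a (Y x) + omega (q x) DY).
Proof.
move=> dG /is_derive_mxP dY; apply/is_derive_mxP => k j.
rewrite (_ : (fun z => _) = fun z =>
    \sum_i Gamma S alpha k j i (q z) * Y z i 0); last first.
  by apply/funext => z; rewrite mxE.
rewrite 3!mxE -big_split /=; apply: is_derive_bigsum => i.
exact: is_derive_mul.
Qed.

Lemma is_derive_conn_local_base v a (Y : 'cV[R]_n -> 'cV[R]_n) DY :
  params S v -> is_derive v a Y DY ->
  is_derive v a (fun z => omega z (Y z)) (domega v a (Y v) + omega v DY).
Proof.
move=> Sv; apply: (@is_derive_conn_local _ id) => k j i.
exact/derivableP/derivable_Gamma.
Qed.

Lemma is_derive_conn_local_frame u w (Y : FT -> 'cV[R]_n) DY :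
  params S u.1 -> is_derive u w Y DY ->
  is_derive u w (fun z => omega z.1 (Y z)) (domega u.1 w.1 (Y u) + omega u.1 DY).
Proof.
move=> Su; apply: (@is_derive_conn_local _ fst) => k j i; apply/is_deriveP.
have /derivableP/is_deriveP := @derivable_Gamma _ _ _ _ _ S alpha k j i _ w.1 Su.
exact.
Qed.

Lemma frame_bundle_near u : frame_bundle S u ->
  \forall z \near u, frame_bundle S z.
Proof.
move=> [Su Uu].
have h1 : \forall z \near u, params S z.1.
  exact: (@cvg_fst _ _ (nbhs u.1) (nbhs u.2) _ _ (params_near Su)).
have h2 : \forall z \near u, z.2 \in unitmx.
  exact: (@cvg_snd _ _ (nbhs u.1) (nbhs u.2) _ _ (unitmx_near Uu)).
by near=> z; split; near: z.
Unshelve. all: by end_near. Qed.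

(** * Horizontal projection, torsion form and curvature form *)

Lemma hor_proj_val u w : frame_bundle S u ->
  hor_proj S alpha u w = (w.1, - (omega u.1 w.1 *m u.2)).
Proof.
move=> Fu; have : [set Z : FT | horizontal S alpha u Z /\ vertical (w - Z)]
    (w.1, - (omega u.1 w.1 *m u.2)).
  by split; [apply/(horizontalE _ _ Fu)|rewrite /vertical /pi_push /= subrr].
by rewrite (hor_projE _ _ Fu) => /= ->.
Qed.

Lemma hor_lift_fst u a : frame_bundle S u -> (hor_lift S alpha u a).1 = a.
Proof.
move=> Fu; have : [set hor_lift S alpha u a] (hor_lift S alpha u a) by [].
by rewrite -(hor_liftE _ _ Fu) => -[].
Qed.

Lemma is_derive_hor_proj u w (Y : FT -> FT) DY : frame_bundle S u ->
  is_derive u w Y DY ->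
  is_derive u w (fun z => hor_proj S alpha z (Y z))
    (DY.1, - ((domega u.1 w.1 (Y u).1 + omega u.1 DY.1) *m u.2 +
              omega u.1 (Y u).1 *m w.2)).
Proof.
move=> Fu dY; have Su := Fu.1.
apply: (@near_eq_is_derive _ _ _
    (fun z => ((Y z).1, - (omega z.1 (Y z).1 *m z.2)))).
  by apply: filterS (frame_bundle_near Fu) => z Fz; rewrite hor_proj_val.
have dY1 := is_derive_fst dY; have dconn := is_derive_conn_local_frame Su dY1.
have dphi := is_derive_snd (is_derive_id u w).
exact: is_derive_pair dY1 (is_deriveN (is_derive_mulmx dconn dphi)).
Qed.

Lemma frame_vector_field_is_derive u w (Y : FT -> FT) :
  frame_vector_field S Y -> frame_bundle S u -> is_derive u w Y ('D_w Y u).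
Proof. exact: smooth_on_is_derive. Qed.

Lemma derive_hor_proj u w (Y : FT -> FT) : frame_bundle S u ->
  frame_vector_field S Y ->
  'D_w (fun z => hor_proj S alpha z (Y z)) u =
  (('D_w Y u).1, - ((domega u.1 w.1 (Y u).1 + omega u.1 ('D_w Y u).1) *m u.2 +
                    omega u.1 (Y u).1 *m w.2)).
Proof.
move=> Fu sY.
by have [_ ->] := is_derive_hor_proj Fu (frame_vector_field_is_derive w sY Fu).
Qed.

(** On a horizontal field theta is [phi^-1 Y]. Differentiating [phi^-1] along a horizontal direction
    produces the omega terms; the derivatives of [X] and [Y] cancel against theta of the bracket. *)
Lemma torsion_formE u (X Y : FT -> FT) : frame_bundle S u ->
  frame_vector_field S X -> frame_vector_field S Y ->
  torsion_form S alpha X Y u =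
  invmx u.2 *m (omega u.1 (X u).1 *m (Y u).1 - omega u.1 (Y u).1 *m (X u).1).
Proof.
move=> Fu sX sY; rewrite /torsion_form /ext_d /lie_bracket /vf_act.
have dtheta w Z : frame_vector_field S Z ->
    'D_w (fun z => canonical_form z (hor_proj S alpha z (Z z))) u =
    - (invmx u.2 *m w.2 *m invmx u.2) *m (Z u).1 + invmx u.2 *m ('D_w Z u).1.
  move=> sZ; apply: (@derive_val _ _ _ u w).
  apply: (@near_eq_is_derive _ _ _ (fun z => invmx z.2 *m (Z z).1)).
    apply: filterS (frame_bundle_near Fu) => z Fz.
    by rewrite (hor_proj_val _ Fz).
  have Uu : \forall z \near u, z.2 \in unitmx.
    by apply: filterS (frame_bundle_near Fu) => z [].
  exact: is_derive_mulmx
    (is_derive_invmx Uu (is_derive_snd (is_derive_id u w)))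
    (is_derive_fst (frame_vector_field_is_derive w sZ Fu)).
rewrite (derive_hor_proj _ Fu sX) (derive_hor_proj _ Fu sY) (dtheta _ _ sX) (dtheta _ _ sY).
rewrite !(hor_proj_val _ Fu) /canonical_form /frame_inv /pi_push /frame_phi /=.
rewrite !mulmxN !mulNmx !opprK !mulmxA !(mulmxK Fu.2) !mulmxBr !mulmxA.
by rewrite [X in _ + X - _]opprD addrACA addrK.
Qed.

(* The curvature 2-form [d omega + omega /\ omega] on the constant fields [a], [b]. *)
Definition curv v a b : 'M[R]_n :=
  domega v a b - domega v b a + omega v a *m omega v b - omega v b *m omega v a.

(** The connection form vanishes identically on horizontal fields near [u], so only minus its value
    on their bracket survives. *)
Lemma curvature_formE u (X Y : FT -> FT) : frame_bundle S u ->
  frame_vector_field S X -> frame_vector_field S Y ->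
  curvature_form S alpha X Y u =
  invmx u.2 *m curv u.1 (X u).1 (Y u).1 *m u.2.
Proof.
move=> Fu sX sY; rewrite /curvature_form /ext_d /lie_bracket /vf_act.
have domega0 w Z :
    'D_w (fun z => conn_form S alpha z (hor_proj S alpha z (Z z))) u = 0.
  rewrite -(derive_cst (0 : 'M[R]_n) u w); apply: near_eq_derive.
  apply: filterS (frame_bundle_near Fu) => z Fz.
  rewrite (hor_proj_val _ Fz).
  by apply/(horizontalE _ _ Fz).
rewrite (derive_hor_proj _ Fu sX) (derive_hor_proj _ Fu sY) !domega0.
rewrite !(hor_proj_val _ Fu) /conn_form /Ad /maurer_cartan invmxK.
rewrite /frame_phi /frame_pi /pi_push /phi_push /= subrr sub0r.
rewrite -mulmxA -mulmxDr -mulmxN -mulmxA.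
apply: (congr1 (mulmx (invmx u.2))).
exact: curvature_form_algebra (conn_localB _ _ _).
Qed.

Lemma alpha_curvatureE (X Y Z : 'cV[R]_n -> 'cV[R]_n) v :
  vector_field S X -> vector_field S Y -> vector_field S Z -> params S v ->
  alpha_nabla S alpha X (alpha_nabla S alpha Y Z) v
  - alpha_nabla S alpha Y (alpha_nabla S alpha X Z) v
  - alpha_nabla S alpha (lie_bracket X Y) Z v = curv v (X v) (Y v) *m Z v.
Proof.
move=> sX sY sZ Sv.
have oS : open (params S) by exact: params_open.
have dd (W : 'cV[R]_n -> 'cV[R]_n) (w a : 'cV[R]_n) : vector_field S W -> params S w ->
  is_derive w a W ('D_a W w) by exact: smooth_on_is_derive.
(* The iterated covariant derivative, fully expanded; it serves both orders of [X] and [Y]. *)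
have nn (A B : 'cV[R]_n -> 'cV[R]_n) : vector_field S A -> vector_field S B ->
    alpha_nabla S alpha A (alpha_nabla S alpha B Z) v =
    'D_(A v) ('D_(B v) Z) v + 'D_('D_(A v) B v) Z v +
    ((domega v (A v) (B v) + omega v ('D_(A v) B v)) *m Z v +
     omega v (B v) *m 'D_(A v) Z v) +
    omega v (A v) *m ('D_(B v) Z v + omega v (B v) *m Z v).
  move=> sA sB; rewrite -(@alpha_nablaE _ _ _ _ _ S alpha B Z v _ Sv (dd _ _ (B v) sZ Sv)).
  apply: alpha_nablaE => //.
  apply: (@near_eq_is_derive _ _ _
      (fun q : 'cV[R]_n => 'D_(B q) Z q + omega q (B q) *m Z q)).
    apply: filterS (params_near Sv) => w Sw.
    by rewrite (@alpha_nablaE _ _ _ _ _ S alpha B Z w _ Sw (dd _ _ (B w) sZ Sw)).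
  apply: is_deriveD.
    exact: is_derive_derive oS Sv sZ (dd _ _ _ sB Sv).
  apply: is_derive_mulmx; last exact: dd.
  exact: is_derive_conn_local_base Sv (dd _ _ _ sB Sv).
rewrite (nn _ _ sX sY) (nn _ _ sY sX)
  (@alpha_nablaE _ _ _ _ _ S alpha (lie_bracket X Y) Z v _ Sv (dd _ _ _ sZ Sv)).
rewrite /curv /lie_bracket /vf_act.
have wL := conn_localB v ('D_(X v) Y v) ('D_(Y v) X v).
have DDZ := smooth_on_schwarz (Y v) (X v) oS sZ Sv.
have DLZ := deriveB_dir ('D_(X v) Y v) ('D_(Y v) X v)
  (smooth_on_differentiable sZ Sv).
exact: curvature_tensor_algebra wL DDZ DLZ.
Qed.

Lemma alpha_flatP :
  alpha_flat S alpha <-> forall v a b, params S v -> curv v a b = 0.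
Proof.
split=> [flat v a b Sv|K0 X Y Z sX sY sZ v Sv]; last first.
  by rewrite alpha_curvatureE// K0// mul0mx.
have sc (c : 'cV[R]_n) : vector_field S (cst c) by exact: smooth_on_cst.
apply/matrixP => i j.
(* Constant fields realize all [a] and [b], and the basis vector reads off column [j]. *)
have := flat _ _ _ (sc a) (sc b) (sc (delta_mx j 0)) v Sv.
rewrite (alpha_curvatureE (sc a) (sc b) (sc _) Sv) -colE => /colP/(_ i).
by rewrite !mxE.
Qed.

Lemma curvature_form_eq0P :
  curvature_form_eq0 S alpha <-> forall v a b, params S v -> curv v a b = 0.
Proof.
split=> [F0 v a b Sv|K0 X Y sX sY u Fu]; last first.
  by rewrite curvature_formE// K0 ?mulmx0 ?mul0mx//; exact: Fu.1.
(* At the identity frame the conjugation by [phi] is trivial. *)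
have Fu : frame_bundle S (v, 1%:M) by split=> //; exact: unitmx1.
have sc (c : FT) : frame_vector_field S (cst c) by exact: smooth_on_cst.
have := F0 _ _ (sc (a, 0)) (sc (b, 0)) _ Fu.
by rewrite (curvature_formE Fu (sc _) (sc _)) /= invmx1 mul1mx mulmx1.
Qed.

Lemma curvature_tensorE u a b c : frame_bundle S u ->
  curvature_tensor S alpha u a b c = curv u.1 a b *m c.
Proof.
move=> Fu; rewrite /curvature_tensor /form2_at /frame_map /frame_inv /frame_phi.
have sc (w : FT) : frame_vector_field S (cst w) by exact: smooth_on_cst.
rewrite (curvature_formE Fu (sc _) (sc _)) /= !hor_lift_fst//.
by rewrite -!mulmxA !(mulKVmx Fu.2).
Qed.

Lemma curvature_tensor_eq0P :
  curvature_tensor_eq0 S alpha <-> forall v a b, params S v -> curv v a b = 0.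
Proof.
split=> [F0 v a b Sv|K0 u Fu a b c]; last first.
  by rewrite curvature_tensorE// K0 ?mul0mx//; exact: Fu.1.
have Fu : frame_bundle S (v, 1%:M) by split=> //; exact: unitmx1.
apply/matrixP => i j; have := F0 _ Fu a b (delta_mx j 0).
by rewrite (curvature_tensorE _ _ _ Fu) -colE => /colP/(_ i); rewrite !mxE.
Qed.

(** * Vanishing of the torsion in its three forms *)

Lemma alpha_torsion_free_holds : alpha_torsion_free S alpha.
Proof.
move=> X Y sX sY v Sv.
rewrite (alpha_nablaE alpha Sv (smooth_on_is_derive _ sY Sv)).
rewrite (alpha_nablaE alpha Sv (smooth_on_is_derive _ sX Sv)).
rewrite (conn_localC _ _ _ Sv) /lie_bracket /vf_act.
by rewrite opprD addrACA subrr addr0 subrr.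
Qed.

Lemma torsion_form_eq0_holds : torsion_form_eq0 S alpha.
Proof.
move=> X Y sX sY u Fu.
by rewrite torsion_formE// (conn_localC _ _ _ Fu.1) subrr mulmx0.
Qed.

Lemma torsion_tensor_eq0_holds : torsion_tensor_eq0 S alpha.
Proof.
move=> u Fu a b; rewrite /torsion_tensor /form2_at /frame_map.
by rewrite torsion_form_eq0_holds ?mulmx0//; exact: smooth_on_cst.
Qed.

(** * Geodesics and horizontal lifts *)

Lemma alpha_nabla_alongE (gamma : R -> 'cV[R]_n) t :
  alpha_nabla_along S alpha gamma (derive1 gamma) t =
  derive1 (derive1 gamma) t +
  omega (gamma t) (derive1 gamma t) *m derive1 gamma t.
Proof.
(* The velocity fills both lower slots of [Gamma], so the column index of omega matches the first of
   them directly. *)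
apply/colP => k; rewrite !mxE; congr (_ + _); apply: eq_bigr => i _.
by rewrite mxE mulr_suml; apply: eq_bigr => j _; rewrite mulrAC.
Qed.

Lemma curve_dom_near (eps t : R) : curve_dom eps t ->
  \forall s \near t, curve_dom eps s.
Proof.
move=> /andP[t1 t2].
have : \forall s \near t, s \in `]- eps, eps[.
  by apply: near_in_itvoo; rewrite in_itv /= t1.
by apply: filterS => s; rewrite in_itv.
Qed.

Lemma is_derive_canonical_form (eps : R) (gamma : R -> 'cV[R]_n) (c : R -> FT) t :
  smooth_curve S eps gamma -> horizontal_lift_curve S alpha eps gamma c ->
  curve_dom eps t ->
  is_derive t (1 : R) (fun s => canonical_form (c s) (derive1 c s))
    (invmx (c t).2 *m alpha_nabla_along S alpha gamma (derive1 gamma) t).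
Proof.
move=> [sg _] [[sc Fc] hc] It.
have derive1D (W : normedModType R) (f : R -> W) : derive1 f = 'D_1 f.
  by apply/funext => s; rewrite derive1E.
have nearI := curve_dom_near It.
have dc s : curve_dom eps s -> is_derive s 1 c ('D_1 c s).
  exact: smooth_on_is_derive.
have dc1 s : curve_dom eps s -> ('D_1 c s).1 = 'D_1 gamma s.
  move=> Is; apply/esym/(@derive_val _ _ _ s 1).
  apply: (@near_eq_is_derive _ _ _ (fun s => (c s).1)).
    by apply: filterS (curve_dom_near Is) => r Ir; have [] := hc _ Ir.
  exact: is_derive_fst (dc _ Is).
have [ct hor] := hc _ It.
have /= := (horizontalE alpha _ (Fc _ It)).1 hor.
(* Horizontality becomes the parallel transport equation [phi' = - omega(gamma') phi]. *)
rewrite /phi_push /frame_pi /pi_push /frame_phi derive1D dc1// -/(frame_pi _) ct.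
move=> phi'.
rewrite alpha_nabla_alongE !derive1D.
apply: (@near_eq_is_derive _ _ _ (fun s => invmx (c s).2 *m 'D_1 gamma s)).
  apply: filterS nearI => s Is.
  by rewrite /canonical_form /frame_inv /pi_push dc1.
have d2 : is_derive t 1 (fun s => (c s).2) ('D_1 c t).2 := is_derive_snd (dc _ It).
have Uc : \forall s \near t, (c s).2 \in unitmx.
  by apply: filterS nearI => s Is; have [] := Fc _ Is.
have dinv := is_derive_invmx Uc d2.
have dg : is_derive t 1 ('D_1 gamma) ('D_1 ('D_1 gamma) t).
  exact: (smooth_on_is_derive (1 : R) (smooth_on_derive (1 : R) sg) It).
have dth := is_derive_mulmx dinv dg.
apply: (is_derive_eq dth).
(* The minus sign of the transport equation cancels the one from differentiating the inverse,
   leaving [phi^-1 omega(gamma')]. *)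
rewrite phi' mulmxN !mulNmx opprK mulmxA (mulmxK (Fc _ It).2) -!mulmxA.
by rewrite -mulmxDr addrC.
Qed.

End FrameBundleGeometry.

Theorem corollary5p10 (R : realType) (d : measure_display)
    (T : measurableType d) (mu : {measure set T -> \bar R}) (n : nat)
    (S : stat_manifold mu n) (alpha : R) :
  (forall (eps : R) (gamma : R -> 'cV[R]_n) (c : R -> 'cV[R]_n * 'M[R]_n),
     0 < eps -> smooth_curve S eps gamma ->
     horizontal_lift_curve S alpha eps gamma c ->
     (alpha_geodesic S alpha eps gamma <->
       (forall t, curve_dom eps t ->
          alpha_nabla_along S alpha gamma (derive1 gamma) t = 0)) /\
     ((forall t, curve_dom eps t ->
          alpha_nabla_along S alpha gamma (derive1 gamma) t = 0) <->
       (forall t, curve_dom eps t ->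
          is_derive t (1 : R) (fun s => canonical_form (c s) (derive1 c s))
            (0 : 'cV[R]_n))))
  /\ ((alpha_torsion_free S alpha <-> torsion_tensor_eq0 S alpha) /\
      (torsion_tensor_eq0 S alpha <-> torsion_form_eq0 S alpha))
  /\ ((alpha_flat S alpha <-> curvature_tensor_eq0 S alpha) /\
      (curvature_tensor_eq0 S alpha <-> curvature_form_eq0 S alpha)).
Proof.
split; last split.
- move=> eps gamma c _ sg hc; split=> //; split=> h t It.
    by rewrite -(mulmx0 _ (invmx (c t).2)) -(h t It);
      exact: is_derive_canonical_form sg hc It.
  (* Conversely, the frame is invertible, so [phi^-1] can be cancelled from the derivative of
     theta. *)
  have Uc := (hc.1.2 t It).2.
  have := derive_val (is_derive := h t It).
  have [_ ->] := is_derive_canonical_form sg hc It.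
  by move=> /(congr1 (mulmx (c t).2)); rewrite mulmx0 (mulKVmx Uc).
- split; split=> _.
  + exact: torsion_tensor_eq0_holds.
  + exact: alpha_torsion_free_holds.
  + exact: torsion_form_eq0_holds.
  + exact: torsion_tensor_eq0_holds.
- split.
    exact: iff_trans (alpha_flatP S alpha) (iff_sym (curvature_tensor_eq0P S alpha)).
  exact: iff_trans (curvature_tensor_eq0P S alpha)
    (iff_sym (curvature_form_eq0P S alpha)).
Qed.
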